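(* Let $I\subset\mathbb{R}$ be a nondegenerate interval, let $n\in\mathbb{N}$, let $\omega=(\omega_1,\dots,\omega_n):I\to\mathbb{R}^n$ be an $n$-dimensional positive Chebyshev system over $I$, and let $\omega_{n+1}:I\to\mathbb{R}$ be such that $\omega^*=(\omega_1,\dots,\omega_n,\omega_{n+1})$ is an $(n+1)$-dimensional positive Chebyshev system over $I$. A function $f:I\to\mathbb{R}$ is $\omega$-Jensen convex on $I$ if and only if, for all $p\in I$, $$\underline{D}_{\,(\mathbf{1}_n,\omega^* )}f(p)\ge0.$$
   Context: $\mathbb{N}$ is the set of positive integers. $\sigma_k(I):=\{(x_1,\dots,x_k)\in I^k\mid x_1<\dots<x_k\}$. For $\omega=(\omega_1,\dots,\omega_k):I\to\mathbb{R}^k$ and $(x_1,\dots,x_k)\in\sigma_k(I)$, $\Phi_\omega(x_1,\dots,x_k):=\det\big(\omega_i(x_j)\big)_{i,j=1}^k$. $\omega$ is a $k$-dimensional positive Chebyshev system over $I$ if $\Phi_\omega>0$ on $\sigma_k(I)$. For an $n$-dimensional $\omega$ and $f:I\to\mathbb{R}$, $(\omega,f):=(\omega_1,\dots,\omega_n,f)$. $f$ is $\omega$-Jensen convex on $I$ if $\Phi_{(\omega,f)}(x,x+h,\dots,x+nh)\ge0$ for all $h>0$ and $x\in I$ with $x+nh\in I$. Put $$[x_0,\dots,x_n;f]_{\omega^*}:=\frac{\Phi_{(\omega,f)}(x_0,\dots,x_n)}{\Phi_{\omega^*}(x_0,\dots,x_n)}\qquad\text{for }(x_0,\dots,x_n)\in\sigma_{n+1}(I).$$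 $\mathbf{1}_n=(1,\dots,1)\in\mathbb{R}^n$, and for $p\in I$ the lower Dinghas type derivative (an extended real number) is $$\underline{D}_{\,(\mathbf{1}_n,\omega^* )}f(p):=\lim_{\delta\to0^+}\inf\Big\{\big[x,\tfrac{n-1}{n}x+\tfrac1n y,\dots,\tfrac1n x+\tfrac{n-1}{n}y,y;f\big]_{\omega^*}: (x,y)\in\sigma_2(I),\ x\le p\le y,\ y-x<\delta\Big\},$$ where the divided difference is taken at the $n+1$ points $\tfrac{n-j}{n}x+\tfrac{j}{n}y$, $j=0,\dots,n$. *)

(* Defs.v *)
From HB Require Import structures.
From mathcomp Require Import all_boot all_order all_algebra.
From mathcomp Require Import all_classical all_reals all_analysis.
Set Implicit Arguments.
Unset Strict Implicit.
Unset Printing Implicit Defensive.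
Import Order.TTheory GRing.Theory Num.Theory.
Import numFieldNormedType.Exports.
Local Open Scope classical_set_scope.
Local Open Scope ring_scope.

(* Functions on an interval I are represented by total functions on R; every
   definition below evaluates them at points of I only. Indices start at 0. *)

Definition simplex (R : realType) (k : nat) (I : set R) : set ('I_k -> R) :=
  [set x : 'I_k -> R | (forall i, I (x i)) /\
                      (forall i j : 'I_k, (i < j)%N -> x i < x j)].

Definition Phi (R : realType) (k : nat) (w : R -> 'rV[R]_k) (x : 'I_k -> R) : R :=
  \det (\matrix_(i < k, j < k) w (x j) 0 i).

Definition positive_chebyshev (R : realType) (k : nat) (I : set R)
    (w : R -> 'rV[R]_k) : Prop :=
  forall x, simplex I x -> 0 < Phi w x.

(* (w_1, ..., w_n, f) *)
Definition extend (R : realType) (n : nat) (w : R -> 'rV[R]_n) (f : R -> R) :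
    R -> 'rV[R]_n.+1 :=
  fun t => \row_(i < n.+1) oapp (fun j : 'I_n => w t 0 j) (f t) (unlift ord_max i).

Definition jensen_convex (R : realType) (n : nat) (I : set R)
    (w : R -> 'rV[R]_n) (f : R -> R) : Prop :=
  forall x h : R, 0 < h -> I x -> I (x + n%:R * h) ->
    0 <= Phi (extend w f) (fun j : 'I_n.+1 => x + j%:R * h).

(* [x_0, ..., x_n; f]_{w*} with w* = (w, g) *)
Definition divided_difference (R : realType) (n : nat) (w : R -> 'rV[R]_n)
    (g f : R -> R) (x : 'I_n.+1 -> R) : R :=
  Phi (extend w f) x / Phi (extend w g) x.

(* j <= n, so the truncated subtraction n - j is exact. *)
Definition subdivision (R : realType) (n : nat) (x y : R) : 'I_n.+1 -> R :=
  fun j => (n - j)%:R / n%:R * x + j%:R / n%:R * y.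

(* The infimum is nonincreasing in delta, so for every p the limit exists in
   \bar R. *)
Definition lower_dinghas (R : realType) (n : nat) (I : set R)
    (w : R -> 'rV[R]_n) (g f : R -> R) (p : R) : \bar R :=
  lim (ereal_inf
         [set (divided_difference w g f (subdivision xy.1 xy.2))%:E | xy in
           [set xy : R * R | [/\ I xy.1, I xy.2, xy.1 < xy.2,
                                 xy.1 <= p <= xy.2 & xy.2 - xy.1 < delta]]]
       @[delta --> (0 : R)^'+]).

(* Main.v *)
(** The divided difference at an equidistant grid is controlled by the ones at
    windows of consecutive points of the grid with half the step: if
    [Phi_(w,F) < 0] at [x, x+h, ..., x+nh], then [Phi_(w,F) < 0] at one of the
    [n+1] windows of step [h/2].  Iterating yields nested intervals shrinking to
    a point [p] at which every infimum in the Dinghas derivative stays below a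
    fixed negative constant [c]; here [F = f - c g], which turns
    [dd f < c] into [Phi_(w,F) < 0].

    The control comes from an exchange argument on [n+2] points
    [u_0 < ... < u_(n+1)].  After subtracting from [F] its [w]-interpolant at
    [u_1, ..., u_n], the determinant omitting an inner point has at most two
    nonzero terms in its expansion along the row of [F], whose signs are those
    of the determinants omitting [u_(n+1)] and [u_0]. *)
Require Import Defs.
From HB Require Import structures.
From mathcomp Require Import all_boot all_order all_algebra.
From mathcomp Require Import all_classical all_reals all_analysis.
From mathcomp Require Import zify ring lra.
Import Order.TTheory GRing.Theory Num.Theory.
Import numFieldNormedType.Exports.
Local Open Scope classical_set_scope.
Local Open Scope ring_scope.

Lemma simplex_nat (R : realType) (I : set R) (k : nat) (t : nat -> R) :
  {homo t : i j / (i < j)%N >-> i < j} ->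
  forall s : 'I_k -> nat, (forall i j : 'I_k, (i < j)%N -> (s i < s j)%N) ->
  (forall i, I (t (s i))) -> simplex I (fun i => t (s i)).
Proof. by move=> tm s sm It; split=> // i j ij; apply/tm/sm. Qed.

(** * Determinants bordered by one extra function *)

Section Determinants.
Variables (R : realType) (n : nat) (w : R -> 'rV[R]_n).
Implicit Types (f g F : R -> R).

Lemma Phi_extend_expand F (x : 'I_n.+1 -> R) :
  Phi (extend w F) x =
  \sum_(j < n.+1) F (x j) * ((-1) ^+ (n + j) * Phi w (fun i => x (lift j i))).
Proof.
rewrite /Phi (expand_det_row _ ord_max); apply: eq_bigr => j _.
rewrite /cofactor !mxE unlift_none /=; congr (_ * (_ * \det _)).
by apply/matrixP => i k; rewrite !mxE liftK.
Qed.

Lemma Phi_extendB f g c (x : 'I_n.+1 -> R) :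
  Phi (extend w (fun t => f t - c * g t)) x =
  Phi (extend w f) x - c * Phi (extend w g) x.
Proof.
rewrite !Phi_extend_expand mulr_sumr -sumrB; apply: eq_bigr => j _; ring.
Qed.

Lemma Phi_extend_component (i : 'I_n) (x : 'I_n.+1 -> R) :
  Phi (extend w (fun t => w t 0 i)) x = 0.
Proof.
rewrite /Phi; apply: (@determinant_alternate _ _ _ ord_max (lift ord_max i)).
  by rewrite neq_lift.
by move=> j; rewrite !mxE unlift_none liftK.
Qed.

(** The determinant is linear in its last row and vanishes when that row repeats a row of [w]. *)
Lemma Phi_extend_sub_span F (a : 'I_n -> R) (x : 'I_n.+1 -> R) :
  Phi (extend w (fun t => F t - \sum_i a i * w t 0 i)) x = Phi (extend w F) x.
Proof.
rewrite -[RHS]subr0 -[X in _ - X](@big1 _ 0 +%R _ (index_enum 'I_n) predT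
  (fun i => a i * Phi (extend w (fun t => w t 0 i)) x)); last first.
  by move=> i _; rewrite Phi_extend_component mulr0.
have -> : \sum_i a i * Phi (extend w (fun t => w t 0 i)) x =
    \sum_(j < n.+1) (\sum_i a i * w (x j) 0 i) *
      ((-1) ^+ (n + j) * Phi w (fun i => x (lift j i))).
  under [RHS]eq_bigr do rewrite mulr_suml.
  rewrite exchange_big /=; apply: eq_bigr => i _.
  rewrite Phi_extend_expand mulr_sumr; apply: eq_bigr => j _; ring.
rewrite !Phi_extend_expand -sumrB; apply: eq_bigr => j _; ring.
Qed.

(** The linear system for [a] has determinant [Phi w y], hence is solvable. *)
Lemma interpolation F (y : 'I_n -> R) : 0 < Phi w y ->
  exists a : 'I_n -> R, forall j, \sum_i a i * w (y j) 0 i = F (y j).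
Proof.
move=> Py; pose M := \matrix_(i < n, j < n) w (y j) 0 i.
have Mu : M \in unitmx by rewrite unitmxE unitfE gt_eqF.
pose a := (\row_j F (y j)) *m invmx M.
exists (fun i => a 0 i) => j.
have /matrixP/(_ 0 j) : a *m M = \row_j F (y j) by rewrite mulmxKV.
by rewrite !mxE => <-; apply: eq_bigr => i _; rewrite !mxE.
Qed.

End Determinants.

(** * From a grid to the windows of a finer grid *)

Section Refinement.
Variables (R : realType) (I : set R) (n : nat) (n_gt0 : (0 < n)%N).
Variables (w : R -> 'rV[R]_n) (w_cheb : positive_chebyshev I w) (F : R -> R).

(** The index maps [i], [i.+1] and [bump j i] omit [u n.+1], [u 0] and the inner point [u j]
    respectively. *)
Lemma Phi_extend_exchange (u : nat -> R) (j : nat) :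
  {homo u : i k / (i < k)%N >-> i < k} ->
  (forall k, (k <= n.+1)%N -> I (u k)) -> (0 < j <= n)%N ->
  0 <= Phi (extend w F) (fun i : 'I_n.+1 => u i) ->
  0 <= Phi (extend w F) (fun i : 'I_n.+1 => u i.+1) ->
  0 <= Phi (extend w F) (fun i : 'I_n.+1 => u (bump j i)).
Proof.
move=> um Iu /andP[j0 jn].
have Pw (s : 'I_n -> nat) : (forall i k : 'I_n, (i < k)%N -> (s i < s k)%N) ->
    (forall i, (s i <= n.+1)%N) -> 0 < Phi w (fun i => u (s i)).
  by move=> sm sn; apply/w_cheb/simplex_nat => // i; apply/Iu.
have [|a aF] := @interpolation _ _ w F (fun i : 'I_n => u i.+1).
  by apply: (Pw (fun i : 'I_n => i.+1)) => // i; have := ltn_ord i; lia.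
rewrite -!(Phi_extend_sub_span _ _ w F a).
set G := fun t => _.
have G0 k : (0 < k <= n)%N -> G (u k) = 0.
  case: k => // k kn; rewrite /G.
  by have := aF (Ordinal kn) => /= ->; rewrite subrr.
rewrite !Phi_extend_expand.
rewrite (bigD1 ord0) //= big1 ?addr0 => [|i i0]; last first.
  rewrite G0 ?mul0r //; move: i0 (ltn_ord i); rewrite -val_eqE /=; lia.
rewrite (bigD1 ord_max) //= big1 ?addr0 => [|i im]; last first.
  rewrite G0 ?mul0r //; move: im (ltn_ord i); rewrite -val_eqE /=; lia.
(* One term of each assumption survives; cancelling its positive minor leaves
   [0 <= G (u 0) * (-1) ^+ n] and [0 <= G (u n.+1)]. *)
rewrite addn0 addnn -mul2n mulnC exprM sqrr_sign mul1r mulrA.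
rewrite pmulr_lge0; last first.
  apply: (Pw (fun i : 'I_n => bump 0 i)) => i.
    by move=> k; rewrite /bump /=; lia.
  by have := ltn_ord i; rewrite /bump; lia.
move=> G_first; rewrite pmulr_lge0; last first.
  apply: (Pw (fun i : 'I_n => (bump n i).+1)) => i.
    by move=> k; rewrite /bump /=; lia.
  by have := ltn_ord i; rewrite /bump; lia.
move=> G_last; apply: sumr_ge0 => i _.
have Pi : 0 < Phi w (fun k => u (bump j (lift i k))).
  apply: (Pw (fun k : 'I_n => bump j (lift i k))) => k.
    by move=> l; rewrite /= /bump; lia.
  by have := ltn_ord k; rewrite /= /bump; lia.
(* As [0 < j <= n], [bump j] fixes 0 and sends [n] to [n.+1]; every other index lands on a zero of
   [G]. *)
have [i0|i0] := eqVneq (i : nat) 0%N.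
  have -> : bump j i = 0%N by rewrite /bump; lia.
  by move: Pi => /ltW; rewrite /= i0 addn0 mulrA; exact: mulr_ge0.
have [im|im] := eqVneq (i : nat) n.
  have -> : bump j i = n.+1 by rewrite /bump; lia.
  move: Pi => /ltW; rewrite /= im addnn -mul2n mulnC exprM sqrr_sign mul1r.
  exact: mulr_ge0.
rewrite G0 ?mul0r //; have := ltn_ord i; rewrite /bump; lia.
Qed.

(** If every step were 1, [s m] would equal [s 0 + m]. The gap found leaves room to insert an
    index. *)
Lemma strict_homo_gap (s : nat -> nat) (m : nat) :
  {homo s : i k / (i < k)%N >-> (i < k)%N} -> (s 0 + m < s m)%N ->
  exists2 j, (j < m)%N & ((s j).+1 < s j.+1)%N.
Proof.
move=> sm; elim: m => [|m IHm] gap; first by rewrite addn0 ltnn in gap.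
have [/IHm[j jm sj]|le_sm] := ltnP (s 0 + m)%N (s m); first by exists j => //; lia.
by exists m => //; lia.
Qed.

(** Induction on the spread [s n - s 0]. With no gap the points form a window. Otherwise an index
    inserted in a gap gives [n + 2] points; dropping the last or the first of them leaves a smaller
    spread, and the exchange lemma drops the inserted one. *)
Lemma Phi_extend_ge0_windows (t : nat -> R) (m : nat) :
  {homo t : i j / (i < j)%N >-> i < j} -> (forall k, (k <= m)%N -> I (t k)) ->
  (forall k, (k + n <= m)%N ->
     0 <= Phi (extend w F) (fun i : 'I_n.+1 => t (k + i)%N)) ->
  forall s : nat -> nat, {homo s : i j / (i < j)%N >-> (i < j)%N} ->
  (s n <= m)%N -> 0 <= Phi (extend w F) (fun i : 'I_n.+1 => t (s i)).
Proof.
move=> tm It win s; have [d] := ubnP (s n - s 0)%N.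
elim: d s => // d IHd s ltd sm snm.
have shomo i j : (i <= j)%N -> (s i + (j - i) <= s j)%N.
  elim: j => [|j IHj]; first by rewrite leqn0 => /eqP->; lia.
  rewrite leq_eqVlt => /predU1P[->|]; first by rewrite subnn addn0.
  by rewrite ltnS => ij; have := IHj ij; have := sm j j.+1 (ltnSn j); lia.
have [gap|nogap] := ltnP (s 0 + n)%N (s n); last first.
  have sE i : (i <= n)%N -> s i = (s 0 + i)%N.
    by move=> le_in; have := shomo 0%N i; have := shomo i n; lia.
  rewrite (_ : (fun i : 'I_n.+1 => _) = (fun i : 'I_n.+1 => t (s 0 + i)%N)).
    by apply: win; rewrite -sE.
  by apply/funext => i; rewrite sE // -ltnS.
have [j jn sj] := strict_homo_gap _ _ sm gap.
(* [e] lists [s] with [(s j).+1] inserted at position [j.+1], an inner position because [j < n]. *)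
pose e k := if (k <= j)%N then s k else if k == j.+1 then (s j).+1 else s k.-1.
have em : {homo e : i k / (i < k)%N >-> (i < k)%N}.
  move=> i k ik; rewrite /e.
  case: (leqP i j) => ij; case: (leqP k j) => kj; try lia; first exact: sm.
    case: (eqVneq k) => [kE|kN]; first by have := shomo i j; lia.
    by apply: sm; lia.
  case: (eqVneq i) => [iE|iN]; case: (eqVneq k) => [kE|kN]; try lia.
    have := shomo j.+1 k.-1; lia.
  by apply: sm; lia.
have e_last : e n.+1 = s n.
  by rewrite /e (_ : (n < j)%N = false); [case: (eqVneq n.+1) => // | ]; lia.
have e_first : e 0%N = s 0%N by rewrite /e.
have eb k : e (bump j.+1 k) = s k.
  rewrite /e /bump; case: (leqP j.+1 k) => jk /=.
    by rewrite (_ : (k < j)%N = false); [case: (eqVneq k.+1) => // | ]; lia.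
  by rewrite add0n ifT.
under [X in Phi _ X]funext do rewrite -eb.
have e_le k : (k <= n.+1)%N -> (e k <= s n)%N.
  rewrite leq_eqVlt -e_last => /predU1P[->//|/em]; lia.
apply: (Phi_extend_exchange (fun k => t (e k))).
- by move=> i k ik; apply/tm/em.
- by move=> k /e_le; move=> ekn; apply/It/(leq_trans ekn).
- lia.
- apply: IHd => //; last by apply: leq_trans (e_le n _) snm.
  by have := em n n.+1; rewrite e_first; lia.
- apply: (IHd (fun k => e k.+1)) => [|i k ik|]; last by rewrite e_last.
  + by have := em 0%N 1%N; rewrite e_last; lia.
  + exact: em.
Qed.

(** The grid of step [h] consists of the even-indexed points of the grid [t] of step [h / 2], so
    nonnegativity on all windows of [t] would contradict the assumption. *)
Lemma Phi_extend_lt0_halve (x h : R) : is_interval I -> 0 < h ->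
  I x -> I (x + n%:R * h) ->
  Phi (extend w F) (fun j : 'I_n.+1 => x + j%:R * h) < 0 ->
  exists x', [/\ x <= x', x' + n%:R * (h / 2) <= x + n%:R * h &
    Phi (extend w F) (fun j : 'I_n.+1 => x' + j%:R * (h / 2)) < 0].
Proof.
move=> Iint h0 Ix Iy neg; apply: contrapT => none.
pose t (k : nat) := x + k%:R * (h / 2).
have tm : {homo t : i j / (i < j)%N >-> i < j}.
  by move=> i j ij; rewrite /t ltrD2l ltr_pM2r ?ltr_nat // divr_gt0.
have t2 k : t k.*2 = x + k%:R * h by rewrite /t -mul2n natrM; field.
have tle i j : (i <= j)%N -> t i <= t j.
  by rewrite leq_eqVlt => /predU1P[->//|/tm/ltW].
have t0 : t 0%N = x by rewrite /t mul0r addr0.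
have It k : (k <= n.*2)%N -> I (t k).
  move=> kn; apply: (Iint _ _ Ix Iy).
  by rewrite -t2 -{1}t0 !tle.
suff : 0 <= Phi (extend w F) (fun j : 'I_n.+1 => t j.*2).
  rewrite leNgt (_ : (fun j : 'I_n.+1 => _) = (fun j : 'I_n.+1 => x + j%:R * h)).
    by rewrite neg.
  by apply/funext => j; rewrite t2.
apply: (Phi_extend_ge0_windows t n.*2 tm It _ double) => //; last first.
  by move=> i j; rewrite ltn_double.
move=> k kn; rewrite leNgt; apply/negP => kneg; apply: none; exists (t k).
have tD i : t (k + i)%N = t k + i%:R * (h / 2).
  by rewrite /t natrD mulrDl addrA.
split; first by rewrite -{1}t0 tle.
  by rewrite -tD -t2 tle.
by under [X in Phi _ X]funext do rewrite -tD.
Qed.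

End Refinement.

(** * Nested intervals shrinking to a point *)

Lemma nested_intervals (R : realType) (a b : nat -> R) :
  (forall k, a k <= a k.+1) -> (forall k, b k.+1 <= b k) ->
  (forall k, a k <= b k) -> exists p, forall k, a k <= p <= b k.
Proof.
move=> /nondecreasing_seqP am /nonincreasing_seqP bm ab.
have ale k l : a k <= b l.
  apply: le_trans (am _ _ (leq_maxl k l)) _.
  exact: le_trans (ab _) (bm _ _ (leq_maxr k l)).
exists (sup (range a)) => k; apply/andP; split.
  apply: ub_le_sup; last by exists k.
  by exists (b 0%N) => _ [l _ <-].
by apply: ge_sup; [exists (a 0%N); exists 0%N | move=> _ [l _ <-]].
Qed.

Lemma halving_point (R : realType) (I : set R) (n : nat) (Q : R -> R -> Prop) :
  is_interval I ->
  (forall x h, 0 < h -> I x -> I (x + n%:R * h) -> Q x h ->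
     exists x', [/\ x <= x', x' + n%:R * (h / 2) <= x + n%:R * h & Q x' (h / 2)]) ->
  forall x h, 0 < h -> I x -> I (x + n%:R * h) -> Q x h ->
  exists2 p, I p & forall d, 0 < d -> exists y k,
    [/\ 0 < k, I y, I (y + n%:R * k),
        y <= p <= y + n%:R * k & n%:R * k < d /\ Q y k].
Proof.
move=> Iint step x h h0 Ix Iy Qxh.
pose ok (z : R * R) := [/\ 0 < z.2, I z.1, I (z.1 + n%:R * z.2) & Q z.1 z.2].
(* The default 0 makes the choice total; it is never reached, since [ok] is preserved along the
   iteration. *)
have /choice[N HN] : forall z : R * R, exists x', ok z ->
    [/\ z.1 <= x', x' + n%:R * (z.2 / 2) <= z.1 + n%:R * z.2 & Q x' (z.2 / 2)].
  move=> z; case: (pselect (ok z)) => [[z0 Iz Iz' Qz]|]; last by exists 0.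
  by have [x' ?] := step _ _ z0 Iz Iz' Qz; exists x'.
pose z k := iter k (fun z : R * R => (N z, z.2 / 2)) (x, h).
have zok k : ok (z k).
  elim: k => [//|k IHk]; have [z0 Iz Iz' _] := IHk.
  have [le1 le2 Qz] := HN _ IHk.
  have z20 : 0 < (z k).2 / 2 by rewrite divr_gt0.
  have le3 : N (z k) <= N (z k) + n%:R * ((z k).2 / 2).
    by rewrite lerDl mulr_ge0 // ltW.
  split => //=; apply: (Iint _ _ Iz Iz'); rewrite ?le1 ?le2 ?andbT //=.
    exact: le_trans le3 le2.
  exact: le_trans le1 le3.
have [p pP] : exists p, forall k, (z k).1 <= p <= (z k).1 + n%:R * (z k).2.
  apply: nested_intervals => k.
  - by have [] := HN _ (zok k).
  - by have [] := HN _ (zok k).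
  - by have [z0 _ _ _] := zok k; rewrite lerDl mulr_ge0 // ltW.
have zh k : (z k).2 = h / 2 ^+ k.
  elim: k => [|k IHk]; first by rewrite expr0 divr1.
  by rewrite /= IHk exprS invfM mulrA mulrAC.
exists p; first by apply: (Iint _ _ Ix Iy); exact: (pP 0%N).
(* This [k] gives [n h / d < k + 1 <= 2 ^ k], so the [k]-th interval is shorter than [d]. *)
move=> d d0; pose k := Num.truncn (n%:R * h / d).
exists (z k).1, (z k).2; have [z0 Iz Iz' Qz] := zok k; do 2!split => //.
rewrite zh mulrA ltr_pdivrMr ?exprn_gt0 // [ltRHS]mulrC -ltr_pdivrMr //.
have : n%:R * h / d < k.+1%:R by apply: truncnS_gt.
move=> /lt_le_trans; apply; rewrite -natrX ler_nat; exact: ltn_expl.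
Qed.

(** * The Dinghas derivative and the equivalence *)

Lemma subdivisionE (R : realType) (n : nat) (x y : R) : (0 < n)%N ->
  @subdivision R n x y = fun j : 'I_n.+1 => x + j%:R * ((y - x) / n%:R).
Proof.
move=> n0; apply/funext => j; rewrite /subdivision natrB ?leq_ord //.
by field; rewrite pnatr_eq0 -lt0n.
Qed.

(** Shrinking [delta] leaves fewer pairs, so the infimum is monotone. Convergence lets bounds on the
    infima pass to [lim]. *)
Lemma lower_dinghas_cvg (R : realType) (I : set R) (n : nat)
    (w : R -> 'rV[R]_n) (g f : R -> R) (p : R) :
  cvg (ereal_inf
         [set (divided_difference w g f (subdivision xy.1 xy.2))%:E | xy in
           [set xy : R * R | [/\ I xy.1, I xy.2, xy.1 < xy.2,
                                 xy.1 <= p <= xy.2 & xy.2 - xy.1 < delta]]]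
       @[delta --> (0 : R)^'+]).
Proof.
apply/cvg_ex; eexists.
apply: (@nonincreasing_at_right_cvge _ _ 0 +oo%O) => // d e _ _ de.
apply: ereal_inf_le_tmp => _ [xy [Ix Iy xy_lt pxy xyd] <-].
by exists xy => //; split => //; apply: lt_le_trans de.
Qed.

Theorem corollary14 (R : realType) (I : set R)
    (I_interval : is_interval I)
    (I_nondegenerate : exists a b : R, [/\ I a, I b & a < b])
    (n : nat) (n_gt0 : (0 < n)%N)
    (w : R -> 'rV[R]_n) (w_cheb : positive_chebyshev I w)
    (g : R -> R) (wg_cheb : positive_chebyshev I (extend w g))
    (f : R -> R) :
  jensen_convex I w f <->
  (forall p : R, I p -> (0 <= lower_dinghas I w g f p)%E).
Proof.
have grid x h : @subdivision R n x (x + n%:R * h) =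
    fun j : 'I_n.+1 => x + j%:R * h.
  rewrite subdivisionE //; apply/funext => j.
  by field; rewrite pnatr_eq0 -lt0n.
have n0R : 0 < n%:R :> R by rewrite ltr0n.
have Pg x h : 0 < h -> I x -> I (x + n%:R * h) ->
    0 < Phi (extend w g) (fun j : 'I_n.+1 => x + j%:R * h).
  move=> h0 Ix Iy; apply: (wg_cheb (fun j : 'I_n.+1 => x + j%:R * h)).
  split=> [i|i j ij]; last by rewrite ltrD2l ltr_pM2r // ltr_nat.
  apply: (I_interval _ _ Ix Iy); apply/andP; split.
    by rewrite lerDl mulr_ge0 // ltW.
  by rewrite lerD2l ler_pM2r // ler_nat leq_ord.
split=> [fJ p Ip|fD x h h0 Ix Iy].
  apply: lime_ge; first exact: lower_dinghas_cvg.
  apply: nearW => d; apply: le_ereal_inf_tmp => _ [[x y] /= [Ix Iy xy _ _] <-].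
  rewrite lee_fin.
  have h0 : 0 < (y - x) / n%:R by rewrite divr_gt0 ?subr_gt0.
  have yE : y = x + n%:R * ((y - x) / n%:R) by field; rewrite gt_eqF.
  rewrite subdivisionE // /divided_difference.
  apply: divr_ge0; first by apply: fJ; rewrite -?yE.
  by apply/ltW/Pg; rewrite -?yE.
rewrite leNgt; apply/negP => f_neg.
have g_pos := Pg _ _ h0 Ix Iy.
(* Half of the negative divided difference: then [c < 0], and the determinant of [F] is half that of
   [f], still negative. *)
pose c := Phi (extend w f) (fun j : 'I_n.+1 => x + j%:R * h) /
          Phi (extend w g) (fun j : 'I_n.+1 => x + j%:R * h) / 2.
have c0 : c < 0 by rewrite /c !pmulr_llt0 ?invr_gt0.
pose F t := f t - c * g t.
have F_neg : Phi (extend w F) (fun j : 'I_n.+1 => x + j%:R * h) < 0.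
  rewrite Phi_extendB /c mulrAC divfK ?gt_eqF //; lra.
have [p Ip pP] := halving_point R I n
  (fun x h => Phi (extend w F) (fun j : 'I_n.+1 => x + j%:R * h) < 0)
  I_interval (fun x h => Phi_extend_lt0_halve R I n n_gt0 w w_cheb F x h I_interval)
  x h h0 Ix Iy F_neg.
suff : (lower_dinghas I w g f p <= c%:E)%E.
  by move=> /(le_trans (fD p Ip)); rewrite lee_fin leNgt c0.
apply: lime_le; first exact: lower_dinghas_cvg.
near=> d; have [|y [k [k0 Iy1 Iy2 pyk [kd neg]]]] := pP d; first by [].
(* The small interval around [p] supplies an admissible pair, whose divided difference is below [c]
   because the determinant of [F] there is negative. *)
apply: (@le_trans _ _
  (divided_difference w g f (subdivision y (y + n%:R * k)))%:E).
  apply: ereal_inf_lbound; exists (y, y + n%:R * k) => //; split => //=.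
    by rewrite ltrDl mulr_gt0.
  by rewrite addrAC subrr add0r.
rewrite lee_fin /divided_difference grid ler_pdivrMr ?Pg //.
by rewrite -subr_le0 -Phi_extendB ltW.
Unshelve. all: by end_near.
Qed.
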